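(* Assume that, conditionally on the latent path, the states factorize as $p_\theta(x_{0:N}\mid z_{0:N})=\prod_{i=0}^N p_\theta(x_i\mid z_{t_i})$. Fix an observation path $y$ (and states $x_{0:N}$) and assume $\mathbb Q_\phi^{x,y}\ll\mathbb P_\theta^y$. Then the conditional log-density of the signal given the observation is bounded below by the functional $\mathcal L(\theta,\phi;x,y)$: $$\log p_\theta(x_{0:N}\mid y_{0:N})\ \ge\ \mathbb E^{\mathbb Q_\phi^{x,y}}\left[\sum_{i=0}^N\log p_\theta(x_i\mid Z_{t_i})\right]-\mathrm{KL}\left(\mathbb Q_\phi^{x,y}\,\|\,\mathbb P_\theta^y\right)=:\mathcal L(\theta,\phi;x_{0:N},y_{0:N}).$$ Furthermore, for fixed $\theta$ and fixed data $(x_{0:N},y_{0:N})$, $$\arg\max_\phi\mathcal L(\theta,\phi;x,y)=\arg\min_\phi\mathrm{KL}\left(\mathbb Q_\phi^{x,y}\,\|\,\Pi_\theta^{x,y}\right),$$ where the model posterior path law is $\Pi_\theta^{x,y}(dz):=\mathbb P_\theta^y(dz\mid x_{0:N})\propto p_\theta(x_{0:N}\mid z)\,\mathbb P_\theta^y(dz)$.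
   Context: Time grid $0=t_0<\dots<t_N=T$; $x_{0:N}=(x_i)_{i=0}^N$ and $y_{0:N}$ are the signal states in $\mathbb R^n$ and the observations at the grid times. The latent space is $\mathcal Z=\mathbb R^{d_\ell}$ and the latent path space is $C([0,T];\mathcal Z)$; for a latent path $z$, $z_{0:N}=(z_{t_i})_{i=0}^N$. Generative latent law. $\mathbb P_\theta^y$ is the law on $C([0,T];\mathcal Z)$ of the solution of $$dZ_t=w_\theta(t,Z_t;y_{[0,t]})\,dt+g_\theta(t,Z_t)u_\phi(t,Z_t;y_{[0,t]})\,dt+g_\theta(t,Z_t)\,dW_t,\qquad Z_0\sim p_\theta(z_0).$$ When optimizing over $\phi$ with $\theta$ fixed, $\mathbb P_\theta^y$ is regarded as fixed (it is indexed by $\theta$ only). Auxiliary (variational) law. $\mathbb Q_\phi^{x,y}$ is the law on $C([0,T];\mathcal Z)$ of the solution of $$dZ_t=f_\phi(t,Z_t;x_{0:N},y_{[0,t]})\,dt+g_\theta(t,Z_t)\,dW_t,\qquad Z_0\sim q_\phi(\cdot\mid x_{0:N},y_{0:N}).$$ The functions $w_\theta,u_\phi,g_\theta,f_\phi$ and densities $p_\theta(z_0),q_\phi(z_0\mid x,y)$ are parametric families, with regularity ensuring that both SDEs are well-posed. Model likelihood. $p_\theta(x_{0:N}\mid z)$ is the conditional density of the states given the latent path; it depends on $z$ only through $z_{0:N}$, and $x_{0:N}$ and $y_{0:N}$ are conditionally independent given $z$. Hence $p_\theta(x_{0:N}\mid y_{0:N})=\int p_\theta(x_{0:N}\mid z)\,\mathbb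 P_\theta^y(dz)$, which is also the normalizing constant of $\Pi_\theta^{x,y}$. $\mathrm{KL}(\cdot\|\cdot)$ is the Kullback–Leibler divergence and $\mathbb E^{\mathbb Q_\phi^{x,y}}$ is expectation with $Z\sim\mathbb Q_\phi^{x,y}$. *)

(* Defs.v *)
From HB Require Import structures.
From mathcomp Require Import all_boot all_order all_algebra.
From mathcomp Require Import all_classical all_reals all_analysis.

Set Implicit Arguments.
Unset Strict Implicit.
Unset Printing Implicit Defensive.

Import Order.TTheory GRing.Theory Num.Theory.
Import numFieldNormedType.Exports.

Local Open Scope classical_set_scope.
Local Open Scope ring_scope.

(* The Borel sigma-algebra of matrices (in particular of column vectors,
   which represent the points of R^d), generated by the entries. *)
Section measurable_matrix.
Context {R : realType} (m n : nat).

Definition matrix_cylinder : set (set 'M[R]_(m, n)) :=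
  [set A | exists i j, exists2 B : set R, measurable B &
    A = [set M : 'M[R]_(m, n) | B (M i j)]].

Let mx_set0 : <<s matrix_cylinder >> set0.
Proof. exact: sigma_algebra0. Qed.

Let mx_setC A : <<s matrix_cylinder >> A -> <<s matrix_cylinder >> (~` A).
Proof. exact: sigma_algebraC. Qed.

Let mx_bigcup (F : (set 'M[R]_(m, n))^nat) :
  (forall i, <<s matrix_cylinder >> (F i)) ->
  <<s matrix_cylinder >> (\bigcup_i (F i)).
Proof. exact: sigma_algebra_bigcup. Qed.

HB.instance Definition _ := @isMeasurable.Build default_measure_display
  'M[R]_(m, n) <<s matrix_cylinder >> mx_set0 mx_setC mx_bigcup.

End measurable_matrix.

(* The path space C([0, T]; R^d), with the sigma-algebra generated by the
   evaluations (it coincides with the Borel sigma-algebra of the sup norm). *)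
Definition path_space {R : realType} (T : R) (d : nat) : Type :=
  continuousType (`[0, T]%classic : set R) 'cV[R]_d.

Section path_space.
Context {R : realType} (T : R) (d : nat).

HB.instance Definition _ := Choice.on (path_space T d).

Definition path0 : path_space T d := 
  [the continuousType (`[0, T]%classic : set R) 'cV[R]_d of cst (0 : 'cV[R]_d)].

HB.instance Definition _ := isPointed.Build (path_space T d) path0.

Definition path_eval (z : path_space T d) : `[0, T]%classic -> 'cV[R]_d :=
  z : continuousType (`[0, T]%classic : set R) 'cV[R]_d.

Definition path_cylinder : set (set (path_space T d)) :=
  [set A | exists t, exists2 B : set 'cV[R]_d, measurable B &
    A = [set z | B (path_eval z t)]].

Let path_set0 : <<s path_cylinder >> set0.
Proof. exact: sigma_algebra0. Qed.

Let path_setC A : <<s path_cylinder >> A -> <<s path_cylinder >> (~` A).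
Proof. exact: sigma_algebraC. Qed.

Let path_bigcup (F : (set (path_space T d))^nat) :
  (forall i, <<s path_cylinder >> (F i)) ->
  <<s path_cylinder >> (\bigcup_i (F i)).
Proof. exact: sigma_algebra_bigcup. Qed.

HB.instance Definition _ := @isMeasurable.Build default_measure_display
  (path_space T d) <<s path_cylinder >> path_set0 path_setC path_bigcup.

(* Value at a real time; the value 0 outside [0, T] is never used. *)
Definition path_at (z : path_space T d) (t : R) : 'cV[R]_d :=
  'valL_0 (path_eval z) t.

End path_space.
Arguments path_eval {R T d}.
Arguments path_at {R T d}.

(* Lebesgue integral over R^d of a nonnegative measurable function, as an
   iterated integral (Tonelli). *)
Fixpoint integral_Rd {R : realType} (d : nat) : ('cV[R]_d -> \bar R) -> \bar R :=
  match d return ('cV[R]_d -> \bar R) -> \bar R with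
  | 0 => fun f => f 0
  | d'.+1 => fun f => (\int[@lebesgue_measure R]_s
      integral_Rd (fun v : 'cV[R]_d' => f (col_mx (s%:M : 'M[R]_1) v)))%E
  end.

Definition has_density {R : realType} (d : nat)
    (mu : set 'cV[R]_d -> \bar R) (p : 'cV[R]_d -> R) : Prop :=
  [/\ measurable_fun setT p, (forall z, 0 <= p z) &
      forall A, measurable A ->
        mu A = integral_Rd (fun z => (p z * \1_A z)%:E)].

Definition is_conditional_density {R : realType} (n d : nat)
    (p : 'cV[R]_n -> 'cV[R]_d -> R) : Prop :=
  [/\ measurable_fun setT (fun q : 'cV[R]_n * 'cV[R]_d => p q.1 q.2),
      (forall x z, 0 <= p x z) &
      forall z, integral_Rd (fun x => (p x z)%:E) = 1%E].

Section stochastic_calculus.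
Context {R : realType} {dO : measure_display} {Omega : measurableType dO}.
Variables (P : probability Omega R) (T : R) (F : R -> set (set Omega)).

Definition is_filtration : Prop :=
  [/\ (forall t, `[0, T]%classic t -> sigma_algebra setT (F t)),
      (forall t, `[0, T]%classic t -> F t `<=` measurable) &
      forall s t, 0 <= s -> s <= t -> t <= T -> F s `<=` F t].

Definition measurable_wrt {d} {U : measurableType d} (G : set (set Omega))
    (X : Omega -> U) : Prop :=
  forall B, measurable B -> G (X @^-1` B).

Definition adapted {d} {U : measurableType d} (X : R -> Omega -> U) : Prop :=
  forall t, `[0, T]%classic t -> measurable_wrt (F t) (X t).

(* The last clause says that, conditionally on F_s, the coordinates of
   W_t - W_s are independent with law N(0, t - s). *)
Definition is_brownian_motion {k : nat} (W : R -> Omega -> 'cV[R]_k) : Prop :=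
  [/\ (forall om, {within `[0, T], continuous (W ^~ om)}),
      {ae P, forall om, W 0 om = 0},
      adapted W &
      forall s t, 0 <= s -> s < t -> t <= T ->
      forall A, F s A -> forall B : 'I_k -> set R, (forall j, measurable (B j)) ->
        (P (A `&` [set om | forall j, B j (W t om j 0 - W s om j 0)%R]) =
         P A * \prod_(j < k) normal_prob 0 (Num.sqrt (t - s)) (B j))%E].

Definition cvg_to0_in_probability (X : nat -> Omega -> \bar R) : Prop :=
  forall eps : R, 0 < eps ->
    P [set om | (eps%:E < X n om)%E] @[n --> \oo] --> 0%E.

(* sum_(i < size) coef_i 1_(time_i, time_(i + 1)] *)
Record simple_process := SimpleProcess {
  sp_size : nat;
  sp_time : nat -> R;
  sp_coef : nat -> Omega -> R }.

Definition is_simple_adapted (h : simple_process) : Prop :=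
  [/\ sp_time h 0 = 0, sp_time h (sp_size h) = T,
      (forall i, (i < sp_size h)%N -> sp_time h i <= sp_time h i.+1),
      (forall i, (i < sp_size h)%N ->
         measurable_wrt (F (sp_time h i)) (sp_coef h i)) &
      (forall i, (i < sp_size h)%N ->
         exists M : R, forall om, `|sp_coef h i om| <= M)].

Definition simple_value (h : simple_process) (t : R) (om : Omega) : R :=
  \sum_(i < sp_size h)
    sp_coef h i om * \1_(`]sp_time h i, sp_time h i.+1]%classic : set R) t.

Definition simple_integral (h : simple_process) (B : R -> Omega -> R)
    (t : R) (om : Omega) : R :=
  \sum_(i < sp_size h) sp_coef h i om *
    (B (Num.min (sp_time h i.+1) t) om - B (Num.min (sp_time h i) t) om).

(* I_t = int_0^t H_s dB_s for a real Brownian motion B: limit in probability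
   of the integrals of simple processes approximating H in L^2([0, T]) in
   probability. *)
Definition is_ito_integral (H B I : R -> Omega -> R) : Prop :=
  [/\ measurable_fun (`[0, T]%classic `*` setT)
        (fun q : R * Omega => H q.1 q.2),
      adapted H,
      {ae P, forall om,
        (\int[@lebesgue_measure R]_(s in `[0%R, T]) (H s om ^+ 2)%:E < +oo)%E},
      (forall t, `[0, T]%classic t -> measurable_fun setT (I t)) &
      exists h : nat -> simple_process,
        [/\ (forall n, is_simple_adapted (h n)),
            cvg_to0_in_probability (fun n om =>
              (\int[@lebesgue_measure R]_(s in `[0%R, T])
                ((simple_value (h n) s om - H s om) ^+ 2)%:E)%E) &
            forall t, `[0, T]%classic t ->
              cvg_to0_in_probability (fun n om =>
                `|simple_integral (h n) B t om - I t om|%:E)]].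

(* dZ_t = b(t, Z_t) dt + g(t, Z_t) dW_t on [0, T]. *)
Definition solves_sde {d k : nat} (b : R -> 'cV[R]_d -> 'cV[R]_d)
    (g : R -> 'cV[R]_d -> 'M[R]_(d, k)) (W : R -> Omega -> 'cV[R]_k)
    (Z : Omega -> path_space T d) : Prop :=
  [/\ adapted (fun t om => path_at (Z om) t),
      {ae P, forall om, forall i,
        (@lebesgue_measure R).-integrable `[0, T]
          (fun s => (b s (path_at (Z om) s) i 0)%:E)} &
      exists I : 'I_d -> 'I_k -> R -> Omega -> R,
        (forall i j, is_ito_integral
           (fun s om => g s (path_at (Z om) s) i j)
           (fun t om => W t om j 0) (I i j)) /\
        (forall t, `[0, T]%classic t -> {ae P, forall om, forall i,
           path_at (Z om) t i 0 = path_at (Z om) 0 i 0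
             + (\int[@lebesgue_measure R]_(s in `[0, t])
                  b s (path_at (Z om) s) i 0)
             + \sum_(j < k) I i j t om})].

End stochastic_calculus.

Section sde_law.
Context {R : realType} (T : R) (d k : nat).
Variables (b : R -> 'cV[R]_d -> 'cV[R]_d) (g : R -> 'cV[R]_d -> 'M[R]_(d, k)).
Variable p0 : 'cV[R]_d -> R.

(* mu is the law on C([0, T]; R^d) of a weak solution of
   dZ_t = b(t, Z_t) dt + g(t, Z_t) dW_t with Z_0 of density p0. *)
Definition is_sde_law (mu : probability (path_space T d) R) : Prop :=
  exists (dO : measure_display) (Omega : measurableType dO)
         (P : probability Omega R) (F : R -> set (set Omega))
         (W : R -> Omega -> 'cV[R]_k) (Z : {mfun Omega >-> path_space T d}),
    [/\ is_filtration T F,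
        is_brownian_motion P T F W,
        solves_sde P F b g W Z,
        has_density (fun A => P [set om | A (path_at (Z om) 0)]) p0 &
        forall A, measurable A -> mu A = distribution P Z A].

(* The SDE is well-posed (Borel coefficients, existence and uniqueness in law)
   and mu is the law of its solution. *)
Definition is_wellposed_sde_law (mu : probability (path_space T d) R) : Prop :=
  [/\ measurable_fun (`[0, T]%classic `*` setT)
        (fun q : R * 'cV[R]_d => b q.1 q.2),
      measurable_fun (`[0, T]%classic `*` setT)
        (fun q : R * 'cV[R]_d => g q.1 q.2),
      is_sde_law mu &
      forall nu, is_sde_law nu -> forall A, measurable A -> nu A = mu A].

End sde_law.

Definition KL {R : realType} {d} {X : measurableType d}
    (mu nu : probability X R) : \bar R :=
  if `[< mu `<< nu >]
  then (\int[mu]_z lne (Radon_Nikodym (charge_of_finite_measure mu) nu z))%E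
  else +oo%E.

Definition argmax {R : realType} {Phi : Type} (f : Phi -> \bar R) : set Phi :=
  [set a | forall b, (f b <= f a)%E].

Definition argmin {R : realType} {Phi : Type} (f : Phi -> \bar R) : set Phi :=
  [set a | forall b, (f a <= f b)%E].

(* Pi(dz) is proportional to l(z) P(dz); since Pi is a probability measure, the
   constant is the inverse of \int l dP, which is then positive and finite. *)
Definition is_posterior {R : realType} {d} {X : measurableType d}
    (l : X -> R) (P Pi : probability X R) : Prop :=
  exists2 c : R, 0 < c & forall A, measurable A ->
    Pi A = (c%:E * \int[P]_(z in A) (l z)%:E)%E.

(* The evidence lower bound for a latent path law Q, where p i is the function
   z |-> p(x_i | z) and tg i the i-th grid time.  Extended real logarithms are
   used because p may vanish.  When KL Q P = +oo, the value is -oo since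
   +oo - +oo = -oo in \bar R. *)
Section elbo.
Context {R : realType} {T : R} {d N : nat}.
Variables (tg : 'I_N.+1 -> `[0, T]%classic) (p : 'I_N.+1 -> 'cV[R]_d -> R).

Definition log_lik (z : path_space T d) : \bar R :=
  (\sum_(i < N.+1) lne (p i (path_eval z (tg i)))%:E)%E.

Definition elbo (P Q : probability (path_space T d) R) : \bar R :=
  ((\int[Q]_z log_lik z) - KL Q P)%E.

(* The expectation exists in [-oo, +oo] and the difference is not oo - oo. *)
Definition elbo_well_defined (P Q : probability (path_space T d) R) : Prop :=
  ((\int[Q]_z (log_lik ^\+ z)) +? - (\int[Q]_z (log_lik ^\- z)))%E /\
  ((\int[Q]_z log_lik z) +? - KL Q P)%E.

End elbo.

(* Main.v *)
(** Write [rho = dQ/dP] and [l] for the likelihood, with evidence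
    [Z = \int l dP].  The tangent inequality [ln (t l / rho) <= t l / rho - 1]
    and [\int (l / rho) dQ <= \int l dP] bound [\int ln l dQ - KL(Q, P)] by
    [t Z - 1 - ln t]; take [t = 1 / Z].  For the second claim, [rho Z / l] is
    the density of [Q] with respect to the posterior [Pi], so that
    [KL(Q, Pi) = ln Z - L(Q)]; this holds in the extended reals because the
    negative part of [ln (dQ/dP)] is always [Q]-integrable (it is at most
    [1 / rho]) and because the ELBO is not of the form [oo - oo].  Hence
    maximizing the ELBO amounts to minimizing the divergence. *)

Require Import Defs.
From HB Require Import structures.
From mathcomp Require Import all_boot all_order all_algebra.
From mathcomp Require Import all_classical all_reals all_analysis.
From mathcomp Require Import measurable_realfun ring.

Set Implicit Arguments.
Unset Strict Implicit.
Unset Printing Implicit Defensive.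

Import Order.TTheory GRing.Theory Num.Theory.
Import numFieldNormedType.Exports.

Local Open Scope classical_set_scope.
Local Open Scope ring_scope.

(** * Integrals of extended real functions that need not be integrable *)

Section integral_lemmas.
Local Open Scope ereal_scope.
Context d (X : measurableType d) (R : realType).
Variable mu : {measure set X -> \bar R}.
Implicit Types f g : X -> \bar R.

(** Positive and negative parts are compared separately, so either integral may be infinite. *)
Lemma ae_le_integral f g : measurable_fun setT f -> measurable_fun setT g ->
  {ae mu, forall x, f x <= g x} -> \int[mu]_x f x <= \int[mu]_x g x.
Proof.
move=> mf mg fg; rewrite integralE [leRHS]integralE; apply: leeB.
- apply: ae_ge0_le_integral => //; try exact: measurable_funepos.
  apply: filterS fg => x fgx _; rewrite !funeposE ge_max !le_max fgx/=.
  by rewrite lexx orbT.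
- apply: ae_ge0_le_integral => //; try exact: measurable_funeneg.
  apply: filterS fg => x fgx _; rewrite !funenegE ge_max !le_max leeN2 fgx/=.
  by rewrite lexx orbT.
Qed.

Lemma integrable_posneg_lty f : measurable_fun setT f ->
  \int[mu]_x f^\+ x < +oo -> \int[mu]_x f^\- x < +oo ->
  mu.-integrable setT f.
Proof.
move=> mf fp fn; apply/integrableP; split => //.
under eq_integral do rewrite -/((abse \o f) _) fune_abse.
rewrite ge0_integralD//; first exact: lte_add_pinfty.
- exact: measurable_funepos.
- exact: measurable_funeneg.
Qed.

Lemma integrable_lty_neg f : measurable_fun setT f ->
  \int[mu]_x f^\- x < +oo -> \int[mu]_x f x < +oo -> mu.-integrable setT f.
Proof.
move=> mf fn; rewrite integralE => fy; apply: integrable_posneg_lty => //.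
rewrite ltey; apply: contraTN fy => /eqP ->.
by rewrite -leNgt addye// eqe_oppLR/= lt_eqF.
Qed.

Lemma integral_gtNy f : \int[mu]_x f^\- x < +oo -> -oo < \int[mu]_x f x.
Proof.
move=> fn; rewrite integralE ltNye adde_eq_ninfty negb_or.
apply/andP; split; first by rewrite gt_eqF// (lt_le_trans _ (integral_ge0 _ _)).
by rewrite eqe_oppLR/= lt_eqF.
Qed.

Lemma integral_ninfty_funeneg f :
  \int[mu]_x f^\- x = +oo -> \int[mu]_x f x = -oo.
Proof. by move=> fn; rewrite integralE fn addeNy. Qed.

(* Only the integrability of [v^\-] is assumed: if [v] is not integrable, both
   sides are [-oo]. *)
Lemma integralB_quasi (u v : X -> R) :
  mu.-integrable setT (EFin \o u) -> measurable_fun setT v ->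
  \int[mu]_x (EFin \o v)^\- x < +oo ->
  \int[mu]_x (u x - v x)%:E = \int[mu]_x (u x)%:E - \int[mu]_x (v x)%:E.
Proof.
move=> iu mv vn.
have mU : measurable_fun setT u by exact/measurable_EFinP/(measurable_int _ iu).
have mV : measurable_fun setT (EFin \o v) by exact/measurable_EFinP.
have muv : measurable_fun setT (fun x => (u x - v x)%:E).
  by apply/measurable_EFinP; exact: measurable_funB.
have [iv|niv] := pselect (mu.-integrable setT (EFin \o v)).
  by under eq_integral do rewrite EFinB; rewrite integralB_EFin.
have -> : \int[mu]_x (v x)%:E = +oo.
  apply/eqP; apply: contrapT => /negP; rewrite -ltey => vy; apply: niv.
  exact: integrable_lty_neg.
rewrite addeNy; apply: integral_ninfty_funeneg.
apply/eqP; apply: contrapT => /negP; rewrite -ltey => uvn; apply: niv.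
(* The positive part of [u - v] is at most [|u| + v^-]. A finite negative part would thus make
   [u - v] integrable, hence also [v = u - (u - v)]. *)
have iuv : mu.-integrable setT (fun x => (u x - v x)%:E).
  apply: integrable_posneg_lty => //.
  apply: (@le_lt_trans _ _
      (\int[mu]_x (`|(EFin \o u) x| + (EFin \o v)^\- x))); last first.
    rewrite ge0_integralD//; last 2 first.
    - by apply: measurableT_comp => //; exact: measurable_int iu.
    - exact: measurable_funeneg.
    by apply: lte_add_pinfty => //; have /integrableP[] := iu.
  apply: ge0_le_integral => //.
  - exact: measurable_funepos.
  - apply: emeasurable_funD; last exact: measurable_funeneg.
    by apply: measurableT_comp => //; exact: measurable_int iu.
  move=> x _; rewrite funeposE/= ge_max; apply/andP; split; last first.
    by rewrite adde_ge0.
  rewrite EFinB; apply: leeD; first by rewrite lee_fin ler_norm.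
  by rewrite funenegE le_max/= lexx.
have -> : EFin \o v = (EFin \o u) \- (fun x => (u x - v x)%:E).
  by apply/funext => x /=; rewrite -EFinB opprB addrCA subrr addr0.
exact: integrableB.
Qed.

End integral_lemmas.

(** * Logarithms and inverses *)

Section lne_lemmas.
Local Open Scope ereal_scope.
Context (R : realType).

(** A vanishing factor makes both sides [-oo], which absorbs every other summand. *)
Lemma lne_prod (I : Type) (s : seq I) (a : I -> R) :
  (forall i, (0 <= a i)%R) ->
  \sum_(i <- s) lne (a i)%:E = lne (\prod_(i <- s) a i)%:E.
Proof.
move=> a0; elim: s => [|i s ih]; first by rewrite !big_nil lne1.
rewrite !big_cons ih; have := a0 i; rewrite le_eqVlt => /orP[/eqP <-|ai].
  by rewrite mul0r (le0_lneNy (lexx _)).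
have : (0 <= \prod_(j <- s) a j)%R by exact: prodr_ge0.
rewrite le_eqVlt => /orP[/eqP <-|ps].
  by rewrite mulr0 (le0_lneNy (lexx _)) addeNy.
by rewrite EFinM lneM// in_itv/= lte_fin ?ai ?ps leey.
Qed.

Lemma measurable_lne_EFin d (X : measurableType d) (f : X -> R) :
  measurable_fun setT f -> measurable_fun setT (fun x => lne (f x)%:E).
Proof.
move=> mf; apply: measurable_fun_ifT => //; first exact: measurable_fun_ler.
by apply/measurable_EFinP; apply: measurableT_comp.
Qed.

Lemma measurable_fun_inv d (X : measurableType d) (f : X -> R) :
  measurable_fun setT f -> measurable_fun setT (fun x => (f x)^-1%R).
Proof.
move=> mf.
(* Off zero, [1 / a = a * exp (- ln (a ^ 2))], a composition of measurable maps; at zero both sides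
   are [0]. *)
rewrite (_ : (fun x => _) = fun x => (f x * expR (- ln (f x * f x)))%R).
  apply: measurable_funM => //; apply: measurableT_comp => //.
  apply: measurableT_comp => //; apply: measurableT_comp => //.
  exact: measurable_funM.
apply/funext => x; have [->|f0] := eqVneq (f x) 0%R.
  by rewrite invr0 mul0r.
rewrite expRN lnK ?posrE; first by rewrite invfM mulrA divff// mul1r.
by rewrite lt_neqAle eq_sym mulf_neq0//= -expr2 sqr_ge0.
Qed.

(* Tangent line of the logarithm at [t^-1]. *)
Lemma lne_le_tangent (t a : R) : (0 < t)%R ->
  lne a%:E <= (t * a - 1 - ln t)%:E.
Proof.
move=> t0; have [a0|a0] := leP a 0%R; first by rewrite le0_lneNy// leNye.
rewrite lne_EFin// lee_fin lerBrDr addrC -lnM ?posrE//.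
rewrite -[leLHS]/(ln (t * a)) -[X in ln X](subrK 1%R) addrC le_ln1Dx//.
by rewrite ltrBrDr addNr mulr_gt0.
Qed.

End lne_lemmas.

(** * Real-valued densities and the divergence expressed through them *)

Definition is_density_wrt (R : realType) d (X : measurableType d)
    (mu nu : set X -> \bar R) (rho : X -> R) : Prop :=
  [/\ measurable_fun setT rho, (forall x, 0 <= rho x) &
      forall A, measurable A -> mu A = (\int[nu]_(x in A) (rho x)%:E)%E].

Section density.
Local Open Scope ereal_scope.
Context d (X : measurableType d) (R : realType).
Variables (mu nu : probability X R).

Lemma density_dominates rho : is_density_wrt mu nu rho -> mu `<< nu.
Proof.
move=> [mrho _ muE] N N0 A mA AN; apply: etrans (muE _ mA) _.
apply: null_set_integral => //; last exact: N0.
by apply/measurable_EFinP; exact: measurable_funTS.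
Qed.

Lemma dominates_density : mu `<< nu -> exists rho, is_density_wrt mu nu rho.
Proof.
move=> munu; exists (fine \o Radon_Nikodym_SigmaFinite.f mu nu); split.
- apply: measurableT_comp => //.
  exact: measurable_int (Radon_Nikodym_SigmaFinite.f_integrable munu).
- by move=> x; apply: fine_ge0; exact: Radon_Nikodym_SigmaFinite.f_ge0.
- move=> A mA; rewrite (Radon_Nikodym_SigmaFinite.f_integral munu)//.
  apply: eq_integral => x _ /=.
  by rewrite fineK// Radon_Nikodym_SigmaFinite.f_fin_num.
Qed.

Section given_density.
Variable rho : X -> R.
Hypothesis rhoP : is_density_wrt mu nu rho.

Let mrho : measurable_fun setT rho. Proof. by case: rhoP. Qed.
Let mErho : measurable_fun setT (EFin \o rho).
Proof. exact/measurable_EFinP. Qed.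
Let munu : mu `<< nu. Proof. exact: density_dominates rhoP. Qed.

Lemma density_ae_eq_Radon_Nikodym_SigmaFinite :
  ae_eq nu setT (Radon_Nikodym_SigmaFinite.f mu nu) (EFin \o rho).
Proof.
apply: integral_ae_eq => //.
  exact: Radon_Nikodym_SigmaFinite.f_integrable.
move=> E _ mE; rewrite -(Radon_Nikodym_SigmaFinite.f_integral munu)//.
by case: rhoP => _ _; exact.
Qed.

Lemma integral_density (f : X -> \bar R) E : (forall x, 0 <= f x) ->
  measurable E -> measurable_fun E f ->
  \int[mu]_(x in E) f x = \int[nu]_(x in E) (f x * (rho x)%:E).
Proof.
move=> f0 mE mf.
rewrite -(Radon_Nikodym_SigmaFinite.change_of_variables munu)//.
apply: ae_eq_integral => //.
- apply: emeasurable_funM => //; apply: measurable_funTS.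
  exact: measurable_int (Radon_Nikodym_SigmaFinite.f_integrable munu).
- by apply: emeasurable_funM => //; exact: measurable_funTS.
- apply: ae_eqe_mul2l; apply: ae_eq_subset (@subsetT _ E) _.
  exact: density_ae_eq_Radon_Nikodym_SigmaFinite.
Qed.

(** The [mu]-mass of [rho = 0] is the integral of [rho] over that set, although [nu] may charge
    it. *)
Lemma density_gt0_ae : {ae mu, forall x, (0 < rho x)%R}.
Proof.
have mN : measurable [set x | (rho x <= 0)%R].
  by rewrite -[X in measurable X]setTI; exact: measurable_fun_ler.
exists [set x | (rho x <= 0)%R]; split => //; last first.
  by move=> x /= /negP; rewrite -leNgt.
case: rhoP => _ rho0 muE; apply: etrans (muE _ mN) _.
apply: integral0_eq => x /= x0; congr EFin.
by apply/eqP; rewrite eq_le x0 rho0.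
Qed.

(** Two versions of the derivative agree [nu]-a.e., hence [mu]-a.e. by domination. *)
Lemma KL_density : KL mu nu = \int[mu]_x lne (rho x)%:E.
Proof.
rewrite /KL asboolT//.
have mlne (f : X -> \bar R) : (forall x, f x \is a fin_num) ->
    measurable_fun setT f -> measurable_fun setT (fun x => lne (f x)).
  move=> ffin mf; rewrite (_ : (fun x => _) = fun x => lne (fine (f x))%:E).
    by apply: measurable_lne_EFin; exact: measurableT_comp.
  by apply/funext => x; rewrite fineK.
apply: ae_eq_integral => //.
- apply: mlne => [x|]; first exact: Radon_Nikodym_fin_num.
  exact: measurable_int (Radon_Nikodym_integrable _).
- exact: measurable_lne_EFin.
apply: (ae_eq_comp (@lne R)).
apply: (null_dominates_ae_eq _ munu) => //.
apply: ae_eq_trans density_ae_eq_Radon_Nikodym_SigmaFinite.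
exact/ae_eq_sym/ae_eq_Radon_Nikodym_SigmaFinite.
Qed.

(** Where [rho] vanishes, [l / rho * rho] is [0] instead of [l]; this is why equality may fail. *)
Lemma integral_div_density_le (l : X -> R) : measurable_fun setT l ->
  (forall x, (0 <= l x)%R) ->
  \int[mu]_x (l x / rho x)%:E <= \int[nu]_x (l x)%:E.
Proof.
move=> ml l0; have [_ rho0 _] := rhoP.
have mlr : measurable_fun setT (fun x => (l x / rho x)%:E).
  apply/measurable_EFinP; apply: measurable_funM => //.
  exact: measurable_fun_inv.
rewrite integral_density//; last by move=> x; rewrite lee_fin divr_ge0.
apply: ge0_le_integral => //.
- by move=> x _; rewrite mule_ge0// lee_fin ?divr_ge0.
- exact: emeasurable_funM.
- exact/measurable_EFinP.
move=> x _; rewrite -EFinM lee_fin.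
have [->|r0] := eqVneq (rho x) 0%R; first by rewrite mulr0.
by rewrite divfK.
Qed.

(** The case [l = 1] of [integral_div_density_le] bounds the integral of [1 / rho] by the total mass
    of [nu]. *)
Lemma integral_lne_density_funeneg_lty :
  \int[mu]_x (fun x => lne (rho x)%:E)^\- x < +oo.
Proof.
apply: (@le_lt_trans _ _ (\int[mu]_x (1 / rho x)%:E)); last first.
  apply: (le_lt_trans (@integral_div_density_le (cst 1%R) _ _)) => //.
  rewrite [X in X < _](_ : _ = \int[nu]_x (cst 1 x))//.
  rewrite integral_cst// mul1e.
  by apply: le_lt_trans (probability_le1 nu measurableT) _; rewrite ltry.
have [_ rho0 _] := rhoP.
apply: ae_ge0_le_integral => //.
- by apply: measurable_funeneg; exact: measurable_lne_EFin.
- by move=> x _; rewrite lee_fin divr_ge0.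
- apply/measurable_EFinP; apply: measurable_funM => //.
  exact: measurable_fun_inv.
apply: filterS density_gt0_ae => x r0 _.
rewrite funenegE lne_EFin// ge_max !lee_fin divr_ge0// andbT.
by rewrite -lnV ?posrE// div1r ltW// ln_sublinear// invr_gt0.
Qed.

Lemma KL_gtNy : -oo < KL mu nu.
Proof.
by rewrite KL_density; exact/integral_gtNy/integral_lne_density_funeneg_lty.
Qed.

(** The real [ln] differs from [lne] only where [rho] vanishes, a [mu]-null set. *)
Lemma KL_density_ln : KL mu nu = \int[mu]_x (ln (rho x))%:E.
Proof.
rewrite KL_density; apply: ae_eq_integral => //.
- exact: measurable_lne_EFin.
- by apply/measurable_EFinP; exact: measurableT_comp.
by apply: filterS density_gt0_ae => x r0 _; exact: lne_EFin.
Qed.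

Lemma integral_ln_density_funeneg_lty :
  \int[mu]_x (EFin \o (fun x => ln (rho x)))^\- x < +oo.
Proof.
rewrite (_ : integral _ _ _ = \int[mu]_x (fun x => lne (rho x)%:E)^\- x).
  exact: integral_lne_density_funeneg_lty.
apply: ae_eq_integral => //.
- apply: measurable_funeneg; apply/measurable_EFinP; exact: measurableT_comp.
- by apply: measurable_funeneg; exact: measurable_lne_EFin.
by apply: filterS density_gt0_ae => x r0 _; rewrite !funenegE lne_EFin.
Qed.

Lemma integrable_ln_density : KL mu nu < +oo ->
  mu.-integrable setT (EFin \o (fun x => ln (rho x))).
Proof.
rewrite KL_density_ln => Ky; apply: integrable_lty_neg => //.
- by apply/measurable_EFinP; exact: measurableT_comp.
- exact: integral_ln_density_funeneg_lty.
Qed.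

End given_density.
End density.

(** * The evidence lower bound and the divergence from the posterior *)

Section evidence_lower_bound.
Local Open Scope ereal_scope.
Context d (X : measurableType d) (R : realType).
Variables (mu nu : probability X R) (l : X -> R).
Hypotheses (ml : measurable_fun setT l) (l0 : forall x, (0 <= l x)%R).
Hypothesis munu : mu `<< nu.

Let mlnl : measurable_fun setT (fun x => lne (l x)%:E).
Proof. exact: measurable_lne_EFin. Qed.

Lemma integral_lne_le_tangent (t : R) : (0 < t)%R ->
  \int[nu]_x (l x)%:E < +oo -> KL mu nu < +oo ->
  \int[mu]_x lne (l x)%:E <=
    t%:E * \int[nu]_x (l x)%:E - (1 + ln t)%:E + KL mu nu.
Proof.
move=> t0 Zy Ky; have [rho rhoP] := dominates_density munu.
have [mrho rho0 _] := rhoP.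
have mlr : measurable_fun setT (fun x => (l x / rho x)%:E).
  apply/measurable_EFinP; apply: measurable_funM => //.
  exact: measurable_fun_inv.
have lr0 x : 0 <= (l x / rho x)%:E by rewrite lee_fin divr_ge0.
have ilr : mu.-integrable setT (fun x => (l x / rho x)%:E).
  apply/integrableP; split => //.
  under eq_integral do rewrite gee0_abs//.
  exact: le_lt_trans (integral_div_density_le rhoP ml l0) Zy.
have ilnr := integrable_ln_density rhoP Ky.
have icst (r : R) : mu.-integrable setT (cst r%:E).
  exact: finite_measure_integrable_cst.
have itlr : mu.-integrable setT (fun x => t%:E * (l x / rho x)%:E).
  exact: integrableZl.
have itlrc : mu.-integrable setT
    (fun x => t%:E * (l x / rho x)%:E - (1 + ln t)%:E).
  exact: integrableB itlr (icst _).
apply: (@le_trans _ _ (\int[mu]_x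
  (t%:E * (l x / rho x)%:E - (1 + ln t)%:E + (ln (rho x))%:E))).
  apply: ae_le_integral => //.
    by apply: emeasurable_funD; [exact: measurable_int itlrc|
                                 exact: measurable_int ilnr].
  apply: filterS (density_gt0_ae rhoP) => x r0.
  have tr0 : (0 < t / rho x)%R by rewrite divr_gt0.
  (* The slope [t / rho x] contributes [- ln t + ln (rho x)], whose last term integrates to the
     divergence. *)
  apply: le_trans (lne_le_tangent (l x) tr0) _.
  rewrite -EFinM -EFinB -EFinD lee_fin ln_div ?posrE// mulrCA !mulrA.
  rewrite (mulrC (l x)) !opprD !opprK !addrA -!mulrA (mulrC (_^-1)%R).
  by rewrite lexx.
rewrite integralD// -(KL_density_ln rhoP) leeD2r//.
rewrite (@integralB _ _ _ mu _ _ _ (cst (1 + ln t)%:E))//.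
rewrite integral_cst// [X in (_ * X)](_ : _ = 1) ?mule1; last first.
  exact: probability_setT.
apply: leeB => //; rewrite integralZl//; apply: lee_wpmul2l.
  by rewrite lee_fin ltW.
exact: (integral_div_density_le rhoP ml l0).
Qed.

Lemma evidence_lower_bound :
  \int[mu]_x lne (l x)%:E - KL mu nu <= lne (\int[nu]_x (l x)%:E).
Proof.
have [rho rhoP] := dominates_density munu.
have KNy := KL_gtNy rhoP.
have Z0 : 0 <= \int[nu]_x (l x)%:E.
  by apply: integral_ge0 => x _; rewrite lee_fin.
have := @integral_lne_le_tangent.
move: KNy Z0; set K := KL mu nu; set Z := \int[nu]_x _; set F := \int[mu]_x _.
case: K => [k| |]// _; last by move=> _ _; rewrite addeNy leNye.
case: Z => [z| |]//; last by move=> _ _; rewrite leey.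
rewrite lee_fin => z0 bound; rewrite leeBlDr//.
have {}bound t : (0 < t)%R -> F <= (t * z - (1 + ln t) + k)%:E.
  by move=> t0; have := bound t t0 (ltry _) (ltry _).
move: z0; rewrite le_eqVlt => /orP[/eqP z0|z0]; last first.
  have zV : (0 < z^-1)%R by rewrite invr_gt0.
  apply: le_trans (bound _ zV) _; rewrite lne_EFin// -EFinD lee_fin.
  by rewrite mulVf ?gt_eqF// lnV ?posrE// opprD addrA subrr add0r opprK.
(* The evidence is zero: let [t] go to infinity in [bound]. *)
rewrite -z0 in bound *; rewrite (le0_lneNy (lexx _)) addNye leeNy_eq.
case: F bound => [r| |]// bound; last by have := bound 1%R ltr01.
(* One finite [t] suffices: with [ln t = k - r] the bound reads [r <= r - 1]. *)
have := bound (expR (k - r)) (expR_gt0 _); rewrite lee_fin mulr0 expRK sub0r.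
rewrite opprD opprB addrA.
by rewrite -subr_ge0 (_ : (_ - _)%R = -1)%R ?ler0N1//; ring.
Qed.

Variables (Pi : probability X R) (c : R).
Hypotheses (c0 : (0 < c)%R).
Hypothesis PiE : forall A, measurable A ->
  Pi A = c%:E * \int[nu]_(x in A) (l x)%:E.

Lemma posterior_density : is_density_wrt Pi nu (fun x => c * l x)%R.
Proof.
split; first exact: measurable_funM.
- by move=> x; rewrite mulr_ge0// ltW.
move=> A mA; rewrite PiE// -ge0_integralZl_EFin//.
- by move=> x _; rewrite lee_fin.
- by apply/measurable_EFinP; exact: measurable_funTS.
- exact: ltW.
Qed.

(** As [l] is nonnegative, this is its zero set: null for the posterior, possibly charged by
    [mu]. *)
Let N := [set x | (l x <= 0)%R].

Let mN : measurable N.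
Proof. by rewrite -[X in measurable X]setTI; exact: measurable_fun_ler. Qed.

(** Chain rule: the quotient of the densities of [mu] and [Pi] with respect to [nu]. Its value [0]
    where [l] vanishes is harmless, that set being [mu]-null. *)
Lemma density_wrt_posterior rho : is_density_wrt mu nu rho ->
  {ae mu, forall x, (0 < l x)%R} ->
  is_density_wrt mu Pi (fun x => rho x / (c * l x))%R.
Proof.
move=> rhoP lgt0; have [mrho rho0 _] := rhoP.
have mcl : measurable_fun setT (fun x => (c * l x)^-1)%R.
  by apply: measurable_fun_inv; exact: measurable_funM.
have mll : measurable_fun setT (fun x => (l x / l x)%:E).
  apply/measurable_EFinP; apply: measurable_funM => //.
  exact: measurable_fun_inv.
split.
- exact: measurable_funM.
- by move=> x; rewrite divr_ge0// mulr_ge0// ltW.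
move=> A mA; rewrite (integral_density posterior_density)//; first last.
- by apply/measurable_EFinP; apply: measurable_funTS; exact: measurable_funM.
- by move=> x; rewrite lee_fin divr_ge0// mulr_ge0// ltW.
(* The factor [l / l] is the indicator of [l <> 0]; against [mu] it is a.e. one. *)
transitivity (\int[nu]_(x in A) ((l x / l x)%:E * (rho x)%:E)); last first.
  apply: eq_integral => x _; rewrite -!EFinM; congr EFin.
  have [->|lx] := eqVneq (l x) 0%R; first by rewrite !(mulr0,mul0r).
  by rewrite divfK ?mulf_neq0 ?(gt_eqF c0)// divff// mul1r.
rewrite -(integral_density rhoP)//; first last.
- exact: measurable_funTS.
- by move=> x; rewrite lee_fin divr_ge0.
rewrite (@ae_eq_integral _ _ _ mu A (cst 1)) ?integral_cst ?mul1e//.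
- exact: measurable_funTS.
- by apply: filterS lgt0 => x lx _; rewrite divff ?gt_eqF.
Qed.

(** Integrates [ln (dmu/dPi) = ln rho - ln c - ln l], valid [mu]-a.e. once [mu] does not charge [N].
    The cases on [KL mu nu] decide which terms may be split off. *)
Lemma KL_posterior :
  (\int[mu]_x (fun x => lne (l x)%:E)^\+ x +?
     - \int[mu]_x (fun x => lne (l x)%:E)^\- x) ->
  (\int[mu]_x lne (l x)%:E +? - KL mu nu) ->
  KL mu Pi = - (ln c)%:E - (\int[mu]_x lne (l x)%:E - KL mu nu).
Proof.
move=> def1 def2; have [rho rhoP] := dominates_density munu.
have [mrho rho0 _] := rhoP.
have [muN|muN] := eqVneq (mu N) 0; last first.
  (* [mu] charges [l = 0] and is not dominated: both sides are [+oo]. *)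
  have -> : KL mu Pi = +oo.
    rewrite /KL asboolF// => muPi; case/eqP: muN; apply: (muPi N) => //.
    apply/measure0_null_setP => //; apply: etrans (PiE mN) _.
    rewrite integral0_eq ?mule0//.
    by move=> x /= lx; congr EFin; apply/eqP; rewrite eq_le lx l0.
  rewrite integral_ninfty_funeneg ?addNye//; apply/eqP; rewrite -leye_eq.
  apply: (@le_trans _ _ (\int[mu]_(x in N) (fun x => lne (l x)%:E)^\- x)).
    rewrite (@eq_integral _ _ _ mu N (cst +oo)) ?integral_cst//; last first.
      by move=> x /set_mem lx; rewrite funenegE le0_lneNy ?lee_fin.
    by rewrite gt0_mulye// lt0e muN measure_ge0.
  apply: ge0_subset_integral => //; exact: measurable_funeneg.
have lgt0 : {ae mu, forall x, (0 < l x)%R}.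
  by exists N; split => // x /= /negP; rewrite -leNgt.
have rhoP' := density_wrt_posterior rhoP lgt0.
have KNy := KL_gtNy rhoP; have KNy' := KL_gtNy rhoP'.
set u := fun x => ln (rho x); set v := fun x => ln (rho x / (c * l x)).
set w := fun x => ln (l x).
have mU : measurable_fun setT u by exact: measurableT_comp.
have mw : measurable_fun setT w by exact: measurableT_comp.
have mv : measurable_fun setT v.
  apply: measurableT_comp => //; by have [] := rhoP'.
have vE : {ae mu, forall x, v x = u x - ln c - w x}%R.
  apply: filterS2 lgt0 (density_gt0_ae rhoP) => x lx rx.
  by rewrite /v ln_div ?posrE ?mulr_gt0// lnM ?posrE// opprD addrA.
have FE : \int[mu]_x lne (l x)%:E = \int[mu]_x (w x)%:E.
  apply: ae_eq_integral => //; first exact/measurable_EFinP.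
  by apply: filterS lgt0 => x lx _; rewrite lne_EFin.
have FpE : \int[mu]_x (fun x => lne (l x)%:E)^\+ x =
           \int[mu]_x (EFin \o w)^\+ x.
  apply: ae_eq_integral => //; first exact: measurable_funepos.
    by apply: measurable_funepos; exact/measurable_EFinP.
  by apply: filterS lgt0 => x lx _; rewrite !funeposE lne_EFin.
have icst (r : R) : mu.-integrable setT (cst r%:E).
  exact: finite_measure_integrable_cst.
have int_cst (r : R) : \int[mu]_x r%:E = r%:E.
  rewrite (_ : \int[mu]_x r%:E = \int[mu]_x cst r%:E x)// integral_cst//.
  by rewrite [X in (_ * X)](_ : _ = 1) ?mule1//; exact: probability_setT.
have [Ky|Ky] := eqVneq (KL mu nu) +oo.
  (* Otherwise [def1] would make the expected log-likelihood [+oo], and [def2] excludes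
     [oo - oo]. *)
  have wp : \int[mu]_x (EFin \o w)^\+ x < +oo.
    rewrite ltey -FpE; apply/eqP => Fp.
    move: def1 def2; rewrite Fp Ky [in X in _ -> X]integralE Fp.
    by case: (\int[mu]_x _^\- x).
  suff -> : KL mu Pi = +oo by rewrite Ky addeNy.
  apply/eqP; apply: contrapT => /negP; rewrite -ltey => Ky'.
  have iv := integrable_ln_density rhoP' Ky'.
  (* With [v] integrable, [u = v + ln c + w] would have integral below [+oo]. The double sign fits
     [integralB_quasi], since the negative part of [- w] is the positive part of [w]. *)
  have : KL mu nu = \int[mu]_x (v x + ln c - - w x)%:E.
    rewrite (KL_density_ln rhoP); apply: ae_eq_integral => //.
    - exact/measurable_EFinP.
    - apply/measurable_EFinP.
      apply: measurable_funB; last exact: measurableT_comp.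
      exact: measurable_funD.
    by apply: filterS vE => x -> _; congr EFin; rewrite /u; ring.
  have ivc : mu.-integrable setT (EFin \o (fun x => v x + ln c)%R).
    by have := integrableD measurableT iv (icst (ln c)).
  have wn : \int[mu]_x (EFin \o (fun x => - w x)%R)^\- x < +oo.
    by rewrite (_ : _ \o _ = \- (EFin \o w)) ?funenegN.
  rewrite integralB_quasi//; last exact: measurableT_comp.
  rewrite Ky => /esym/eqP; apply/negP; rewrite -ltey.
  apply: lte_add_pinfty; first exact: integrable_lty ivc.
  by rewrite lteNl; apply: integral_gtNy.
have {}Ky : KL mu nu < +oo by rewrite ltey.
have iu := integrable_ln_density rhoP Ky.
have iuc : mu.-integrable setT (EFin \o (fun x => u x - ln c)%R).
  by have := integrableB measurableT iu (icst (ln c)).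
(* Solving for [ln l] leaves [v] as the only term that may fail to be integrable, which also covers
   [KL mu Pi = +oo]. *)
have : \int[mu]_x lne (l x)%:E = \int[mu]_x (u x - ln c - v x)%:E.
  rewrite FE; apply: ae_eq_integral => //; first exact/measurable_EFinP.
    apply/measurable_EFinP; apply: measurable_funB => //.
    exact: measurable_funB.
  apply: filterS vE => x -> _; congr EFin.
  by rewrite opprB addrCA subrr addr0.
rewrite integralB_quasi//; last exact: integral_ln_density_funeneg_lty rhoP'.
have -> : \int[mu]_x (u x - ln c)%:E = KL mu nu - (ln c)%:E.
  rewrite (KL_density_ln rhoP); under eq_integral do rewrite EFinB.
  by rewrite integralB_EFin ?int_cst//; exact: icst.
rewrite -(KL_density_ln rhoP') => ->.
move: Ky KNy KNy'; case: (KL mu nu) => [k| |]// _ _.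
case: (KL mu Pi) => [k'| |]// _.
by rewrite -!(EFinN,EFinD); congr EFin; ring.
Qed.

End evidence_lower_bound.

(** * Application to path space *)

Lemma measurable_path_eval (R : realType) (T : R) (d : nat)
    (t : `[0, T]%classic) :
  measurable_fun setT (fun z : path_space T d => path_eval z t).
Proof.
move=> _ B mB; rewrite setTI; apply: sub_sigma_algebra.
by exists t; exists B.
Qed.

(** For finite [a], subtraction from [a] reverses the order on all extended reals, so infinite
    values need no separate treatment. *)
Lemma argmax_argmin_reflect (R : realType) (Phi : Type) (L K : Phi -> \bar R)
    (a : R) :
  (forall phi, K phi = (a%:E - L phi)%E) -> argmax L = argmin K.
Proof.
have mono (x y : \bar R) : (a%:E - x <= a%:E - y)%E = (y <= x)%E.
  by rewrite leeD2lE// leeN2.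
move=> KE; apply/seteqP; split => phi opt psi.
  by rewrite !KE mono; exact: opt.
by rewrite -mono -!KE; exact: opt.
Qed.

Theorem theorem4p1 (R : realType)
  (* dimensions of the states, observations, latent space and noise *)
  (n m dl k : nat)
  (* time grid 0 = t_0 < ... < t_N = T *)
  (T : R) (N : nat) (tg : 'I_N.+1 -> `[0, T]%classic)
  (tg_first : set_val (tg ord0) = 0)
  (tg_last : set_val (tg ord_max) = T)
  (tg_incr : forall i j : 'I_N.+1, (i < j)%N -> set_val (tg i) < set_val (tg j))
  (* model and variational parameters *)
  (Theta Phi : Type)
  (* coefficients; an observation path enters through its restriction to [0, t] *)
  (w : Theta -> forall t : R,
         'cV[R]_dl -> (`[0, t]%classic -> 'cV[R]_m) -> 'cV[R]_dl)
  (u : Phi -> forall t : R,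
         'cV[R]_dl -> (`[0, t]%classic -> 'cV[R]_m) -> 'cV[R]_k)
  (g : Theta -> R -> 'cV[R]_dl -> 'M[R]_(dl, k))
  (f : Phi -> forall t : R, 'cV[R]_dl -> ('I_N.+1 -> 'cV[R]_n) ->
         (`[0, t]%classic -> 'cV[R]_m) -> 'cV[R]_dl)
  (* initial densities p_theta(z_0) and q_phi(z_0 | x, y) *)
  (p0 : Theta -> 'cV[R]_dl -> R)
  (q0 : Phi -> 'cV[R]_dl ->
         ('I_N.+1 -> 'cV[R]_n) -> ('I_N.+1 -> 'cV[R]_m) -> R)
  (* p_theta(x_{0:N} | z, y_{0:N}), p_theta(x_{0:N} | z),
     p_theta(x_{0:N} | z_{0:N}) and p_theta(x_i | z_{t_i}) *)
  (pX_zy : Theta -> ('I_N.+1 -> 'cV[R]_n) ->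
         path_space T dl -> ('I_N.+1 -> 'cV[R]_m) -> R)
  (pX_z : Theta -> ('I_N.+1 -> 'cV[R]_n) -> path_space T dl -> R)
  (pX_zgrid : Theta -> ('I_N.+1 -> 'cV[R]_n) -> ('I_N.+1 -> 'cV[R]_dl) -> R)
  (pXi : Theta -> 'I_N.+1 -> 'cV[R]_n -> 'cV[R]_dl -> R)
  (* fixed theta, states x_{0:N} and observation path y *)
  (theta : Theta) (x : 'I_N.+1 -> 'cV[R]_n) (y : R -> 'cV[R]_m)
  (* x_{0:N} and y_{0:N} are conditionally independent given z *)
  (cond_indep : forall x' z y', pX_zy theta x' z y' = pX_z theta x' z)
  (* dependence on z through z_{0:N} only, and factorization *)
  (lik_grid : forall x' z,
     pX_z theta x' z = pX_zgrid theta x' (fun i => path_eval z (tg i)))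
  (lik_density : forall i, is_conditional_density (pXi theta i))
  (lik_factor : forall x' zg,
     pX_zgrid theta x' zg = \prod_(i < N.+1) pXi theta i (x' i) (zg i))
  (* generative law P_theta^y: the parameter phi0 of the control u in its drift
     is arbitrary and frozen while phi varies *)
  (phi0 : Phi) (P : probability (path_space T dl) R)
  (P_law : is_wellposed_sde_law
     (fun t z => w theta t z (sigL `[0, t] y)
                 + g theta t z *m u phi0 t z (sigL `[0, t] y))
     (g theta) (p0 theta) P)
  (* variational laws Q_phi^{x,y} *)
  (Q : Phi -> probability (path_space T dl) R)
  (Q_law : forall phi, is_wellposed_sde_law
     (fun t z => f phi t z x (sigL `[0, t] y))
     (g theta) (fun z0 => q0 phi z0 x (fun i => y (set_val (tg i)))) (Q phi)) :
  (* p_theta(x_{0:N} | y_{0:N}) and L(theta, phi; x, y) *)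
  let p_x_given_y :=
    (\int[P]_z (pX_zy theta x z (fun i => y (set_val (tg i))))%:E)%E in
  let L := fun phi => elbo tg (fun i => pXi theta i (x i)) P (Q phi) in
  (forall phi, Q phi `<< P -> (L phi <= lne p_x_given_y)%E)
  /\
  ((forall phi, Q phi `<< P) ->
   (forall phi,
      elbo_well_defined tg (fun i => pXi theta i (x i)) P (Q phi)) ->
   forall Pi : probability (path_space T dl) R,
     is_posterior (pX_z theta x) P Pi ->
     argmax L = argmin (fun phi => KL (Q phi) Pi)).
Proof.
move=> p_x_given_y L; pose l := pX_z theta x.
have lE z : l z = \prod_(i < N.+1) pXi theta i (x i) (path_eval z (tg i)).
  by rewrite /l lik_grid lik_factor.
have l0 z : 0 <= l z.
  by rewrite lE prodr_ge0// => i _; have [_ + _] := lik_density i; exact.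
have ml : measurable_fun setT l.
  rewrite (funext lE).
  apply: measurable_prod => i _; have [mp _ _] := lik_density i.
  have mpi : measurable_fun setT (pXi theta i (x i)).
    (* Sections of a jointly measurable function are measurable. *)
    exact: (measurableT_comp mp (pair1_measurable (x i))).
  exact: (measurableT_comp mpi (measurable_path_eval (tg i))).
have logE : log_lik tg (fun i => pXi theta i (x i)) = fun z => lne (l z)%:E.
  apply/funext => z; rewrite lE /log_lik lne_prod// => i.
  by have [_ + _] := lik_density i; exact.
have pE : p_x_given_y = (\int[P]_z (l z)%:E)%E.
  by apply: eq_integral => z _; rewrite cond_indep.
split=> [phi QP|QP wd Pi [c c0 PiE]].
  by rewrite /L /elbo logE pE; exact: evidence_lower_bound.
(* Since [Pi] has mass one, [c] is the inverse of the evidence and [- ln c] is the log-evidence,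
   independent of [phi]. *)
apply: (@argmax_argmin_reflect _ _ _ _ (- ln c)) => phi.
have [] := wd phi; rewrite logE => wd1 wd2.
rewrite /L /elbo logE EFinN.
exact: (KL_posterior ml l0 (QP phi) c0 PiE).
Qed.
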